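(* Let $K$ be an abelian group and let $Q$ be a Steiner loop. There exists a nonflexible C-loop $C$ with center $Z(C)\cong K$ and $C/Z(C)\cong Q$ if and only if $|Q|>2$ and $K$ is not an elementary abelian $2$-group. Moreover, when these conditions hold, $C$ can be chosen so that in addition $Z(C)=N(C)$.
   Context: A C-loop is a loop satisfying $x(y\cdot yz) = (xy\cdot y)z$. A loop is flexible if it satisfies $x\cdot yx = xy\cdot x$, and nonflexible otherwise. A Steiner loop is an inverse property loop of exponent two; equivalently, a commutative loop satisfying $x\cdot xy=y$. The nucleus $N(C)$ of a loop $C$ is the set of all $a\in C$ with $a(xy)=(ax)y$, $x(ay)=(xa)y$ and $x(ya)=(xy)a$ for all $x,y\in C$; the center $Z(C)$ is the set of all $a\in N(C)$ with $ax=xa$ for all $x\in C$ (it is a normal subloop). An elementary abelian $2$-group is an abelian group in which every element squares to the identity (the trivial group included). *)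

(* Defs.v *)
From HB Require Import structures.
From mathcomp Require Import all_boot.
From mathcomp Require Import boolp classical_sets functions cardinality.

Set Implicit Arguments.
Unset Strict Implicit.
Unset Printing Implicit Defensive.

Local Open Scope classical_set_scope.
Local Open Scope group_scope.
Local Open Scope quotient_scope.

HB.mixin Record UMagma_isLoop C of UMagma C := {
  loop_ldiv : forall a b : C, exists! x, a * x = b;
  loop_rdiv : forall a b : C, exists! y, y * a = b
}.

#[short(type="loopType")]
HB.structure Definition Loop := {C of UMagma_isLoop C & UMagma C}.

Lemma image_injective (T U : Type) (f : T -> U) (A B : set T) :
  injective f -> f @` A = f @` B -> A = B.
Proof.
by move=> fI AB; apply/predeqP => x; rewrite -!(image_inj fI) AB.
Qed.

Definition isomorphic (G H : magmaType) : Prop :=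
  exists f : {multiplicative G -> H}, bijective f.

Section LoopClasses.
Variable C : loopType.
Implicit Types x y z : C.

Definition C_loop := forall x y z, x * (y * (y * z)) = ((x * y) * y) * z.

Definition flexible := forall x y, x * (y * x) = (x * y) * x.

Definition inverse_property_loop := forall x, exists x', forall y,
  x' * (x * y) = y /\ (y * x) * x' = y.

(* The trivial loop counts as having exponent two. *)
Definition exponent_two := forall x, x * x = 1.

Definition steiner_loop := inverse_property_loop /\ exponent_two.

Lemma loop_mulgI x : injective (mul x).
Proof.
move=> y z xyz; have [u [_ uu]] := loop_ldiv x (x * z).
by rewrite -(uu y xyz) -(uu z erefl).
Qed.

Lemma loop_mulIg x : injective (mul^~ x).
Proof.
move=> y z xyz; have [u [_ uu]] := loop_rdiv x (z * x).
by rewrite -(uu y xyz) -(uu z erefl).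
Qed.

Lemma steiner_loopP :
  steiner_loop <-> commutative (@mul C) /\ forall x y, x * (x * y) = y.
Proof.
split=> [[ip e2]|[cC st]]; last first.
  have e2 x : x * x = 1 by rewrite -[X in x * X]mulg1 st.
  by split=> // x; exists x => y; split; [exact: st | rewrite cC [y * x]cC].
have inv x y : x * (x * y) = y /\ (y * x) * x = y.
  have [x' xP] := ip x; suff E : x = x' by rewrite -E in xP; exact: xP.
  by apply: (@loop_mulIg x); rewrite e2; have [] := xP 1; rewrite mulg1.
split=> [x y|x y]; last by case: (inv x y).
have h : (x * y) * x = y.
  apply: (@loop_mulgI (x * y)); rewrite (inv _ _).1.
  by rewrite (inv y x).2.
by rewrite -{2}h (inv x (x * y)).2.
Qed.

Definition nucleus : set C := [set a |
  [/\ forall x y, a * (x * y) = (a * x) * y,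
      forall x y, x * (a * y) = (x * a) * y &
      forall x y, x * (y * a) = (x * y) * a]].

Definition center : set C := [set a | nucleus a /\ forall x, a * x = x * a].

Definition llcoset (x : C) (N : set C) : set C := [set x * z | z in N].
Definition rlcoset (N : set C) (x : C) : set C := [set z * x | z in N].

Definition subloop (N : set C) : Prop :=
  [/\ N 1,
      forall a b, N a -> N b -> N (a * b),
      forall a b, N a -> N (a * b) -> N b &
      forall a b, N b -> N (a * b) -> N a].

Definition normal_subloop (N : set C) : Prop :=
  [/\ subloop N,
      forall x, llcoset x N = rlcoset N x,
      forall x y, llcoset x (llcoset y N) = llcoset (x * y) N &
      forall x y, rlcoset (rlcoset N x) y = rlcoset N (x * y)].

Lemma center_subloop : subloop center.
Proof.
have Z1 : center 1 by split; [split=> x y|move=> x]; rewrite !(mul1g, mulg1).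
have ZM a b : center a -> center b -> center (a * b).
  move=> [[a1 a2 a3] ac] [[b1 b2 b3] bc]; split; first split=> x y.
  - by rewrite -!a1 b1.
  - by rewrite -a1 a2 b2 a2.
  - by rewrite a2 b3 a3 a2.
  - by move=> x; rewrite -a1 bc a1 ac a2.
have ZV a : center a -> exists2 a', center a' & a * a' = 1 /\ a' * a = 1.
  move=> [[a1 a2 a3] ac]; have [a' [aa' _]] := loop_ldiv a 1.
  have a'a : a' * a = 1 by rewrite -ac.
  exists a' => //; split; first split=> x y.
  - by apply: (@loop_mulgI a); rewrite !a1 aa' !mul1g.
  - have {2}-> : y = a * (a' * y) by rewrite a1 aa' mul1g.
    by rewrite a2 -a3 a'a mulg1.
  - by apply: (@loop_mulIg a); rewrite -!a3 a'a !mulg1.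
  - move=> x; apply: (@loop_mulgI a).
    by rewrite a1 aa' mul1g a1 ac -a2 aa' mulg1.
split=> // a b => [Za Zab|Zb Zab].
- have [a' Za' [_ a'a]] := ZV a Za.
  have -> : b = a' * (a * b) by case: Za' => [[-> _ _] _]; rewrite a'a mul1g.
  exact: ZM.
- have [b' Zb' [bb' _]] := ZV b Zb.
  have -> : a = (a * b) * b'.
    by case: Zb' => [[_ _ h] _]; rewrite -h bb' mulg1.
  exact: ZM.
Qed.

Lemma center_normal : normal_subloop center.
Proof.
split; first exact: center_subloop.
- by move=> x; apply/seteqP; split=> _ [a Za <-]; exists a => //;
    case: (Za) => _ ->.
- move=> x y; apply/seteqP; split.
  + by move=> _ [_ [a Za <-] <-]; exists a => //; case: Za => [[_ _ ->]].
  + move=> _ [a Za <-]; exists (y * a); first by exists a.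
    by case: Za => [[_ _ ->]].
- move=> x y; apply/seteqP; split.
  + by move=> _ [_ [a Za <-] <-]; exists a => //; case: Za => [[->]].
  + move=> _ [a Za <-]; exists (a * x); first by exists a.
    by case: Za => [[->]].
Qed.

End LoopClasses.

Arguments nucleus : clear implicits.
Arguments center : clear implicits.
Arguments center_subloop : clear implicits.
Arguments center_normal : clear implicits.

Definition subloop_type (C : loopType) (N : set C) (sN : subloop N) : Type :=
  set_type N.

Section SubloopType.
Variables (C : loopType) (N : set C) (sN : subloop N).

HB.instance Definition _ := SubChoice.on (subloop_type sN).

Lemma subloop_umagma_closed : umagma_closed (fun x : C => x \in N).
Proof.
have [N1 NM _ _] := sN; split=> [|x y]; first exact: mem_set.
by move=> /set_mem Nx /set_mem Ny; apply/mem_set/NM.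
Qed.

HB.instance Definition _ :=
  SubChoice_isSubUMagma.Build C (fun x : C => x \in N) (subloop_type sN)
    subloop_umagma_closed.

End SubloopType.

Section SubloopLoop.
Variables (C : loopType) (N : set C) (sN : subloop N).
Notation T := (subloop_type sN).

Lemma subloop_ldiv (a b : T) : exists! x : T, a * x = b.
Proof.
have [_ _ Nl _] := sN; have [x [axb _]] := loop_ldiv (val a) (val b).
have Nx : x \in N.
  apply/mem_set/(Nl (val a)); first exact/set_mem/valP.
  by rewrite axb; exact/set_mem/valP.
exists (Sub x Nx : T); split.
  by apply: val_inj; rewrite valM SubK.
move=> y ayb; apply: val_inj; rewrite SubK; apply: (@loop_mulgI _ (val a)).
by rewrite axb -ayb valM.
Qed.

Lemma subloop_rdiv (a b : T) : exists! y : T, y * a = b.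
Proof.
have [_ _ _ Nr] := sN; have [x [xab _]] := loop_rdiv (val a) (val b).
have Nx : x \in N.
  apply/mem_set/(Nr _ (val a)); first exact/set_mem/valP.
  by rewrite xab; exact/set_mem/valP.
exists (Sub x Nx : T); split.
  by apply: val_inj; rewrite valM SubK.
move=> y yab; apply: val_inj; rewrite SubK; apply: (@loop_mulIg _ (val a)).
by rewrite /= xab -yab valM.
Qed.

HB.instance Definition _ := UMagma_isLoop.Build T subloop_ldiv subloop_rdiv.

End SubloopLoop.

Section Quotient.
Variables (C : loopType) (N : set C).

Definition coset_eq : rel C := fun x y => `[< llcoset x N = llcoset y N >].

Lemma coset_eq_refl : reflexive coset_eq.
Proof. by move=> x; apply/asboolP. Qed.

Lemma coset_eq_sym : symmetric coset_eq.
Proof. by move=> x y; apply/asboolP/asboolP => ->. Qed.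

Lemma coset_eq_trans : transitive coset_eq.
Proof. by move=> y x z /asboolP xy /asboolP yz; apply/asboolP; rewrite xy. Qed.

Canonical coset_equiv :=
  EquivRel coset_eq coset_eq_refl coset_eq_sym coset_eq_trans.

(* C / N, the loop of cosets of N; its product is determined by
   (x N) (y N) = (x y) N, see pi_loop_quotientM. *)
Definition loop_quotient (nN : normal_subloop N) : Type :=
  {eq_quot coset_equiv}.

Variable nN : normal_subloop N.
Notation Q := (loop_quotient nN).

HB.instance Definition _ := Choice.on Q.
HB.instance Definition _ := EqQuotient.on Q.

Lemma pi_loop_quotientP x y :
  \pi_Q x = \pi_Q y <-> llcoset x N = llcoset y N.
Proof.
by split=> [/eqP|xy]; [rewrite eqmodE => /asboolP|
  apply/eqP; rewrite eqmodE; apply/asboolP].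
Qed.

Definition loop_quotient_mul (u v : Q) : Q := \pi_Q (repr u * repr v).

HB.instance Definition _ := hasMul.Build Q loop_quotient_mul.

Lemma llcosetM x x' y y' :
  llcoset x N = llcoset x' N -> llcoset y N = llcoset y' N ->
  llcoset (x * y) N = llcoset (x' * y') N.
Proof.
have [_ LR LL RR] := nN => xx' yy'.
by rewrite -LL yy' LL LR -RR -LR xx' LR RR -LR.
Qed.

Lemma pi_loop_quotientM x y : \pi_Q (x * y) = \pi_Q x * \pi_Q y.
Proof.
by apply/pi_loop_quotientP/llcosetM; apply/pi_loop_quotientP; rewrite reprK.
Qed.

Lemma loop_quotient_mul1g : left_id (\pi_Q 1) (@mul Q).
Proof. by move=> u; rewrite -[u]reprK -pi_loop_quotientM mul1g. Qed.

Lemma loop_quotient_mulg1 : right_id (\pi_Q 1) (@mul Q).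
Proof. by move=> u; rewrite -[u]reprK -pi_loop_quotientM mulg1. Qed.

HB.instance Definition _ :=
  Magma_isUMagma.Build Q loop_quotient_mul1g loop_quotient_mulg1.

Lemma loop_quotient_ldiv (u v : Q) : exists! x : Q, u * x = v.
Proof.
have [_ LR LL RR] := nN.
have [x [uxv _]] := loop_ldiv (repr u) (repr v).
have uxv' : u * \pi_Q x = v.
  by rewrite -[u]reprK -pi_loop_quotientM uxv reprK.
exists (\pi_Q x); split=> // w; rewrite -uxv' -[u]reprK -[w]reprK.
rewrite -!pi_loop_quotientM => /pi_loop_quotientP; rewrite -!LL => h.
apply/pi_loop_quotientP/(image_injective (f := mul (repr u))) => //.
exact: loop_mulgI.
Qed.

Lemma loop_quotient_rdiv (u v : Q) : exists! y : Q, y * u = v.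
Proof.
have [_ LR LL RR] := nN.
have [x [xuv _]] := loop_rdiv (repr u) (repr v).
have xuv' : \pi_Q x * u = v.
  by rewrite -[u]reprK -pi_loop_quotientM xuv reprK.
exists (\pi_Q x); split=> // w; rewrite -xuv' -[u]reprK -[w]reprK.
rewrite -!pi_loop_quotientM => /pi_loop_quotientP; rewrite !LR -!RR => h.
apply/pi_loop_quotientP; rewrite !LR.
apply: (image_injective (f := mul^~ (repr u))) => //.
exact: loop_mulIg.
Qed.

HB.instance Definition _ :=
  UMagma_isLoop.Build Q loop_quotient_ldiv loop_quotient_rdiv.

End Quotient.

Definition elementary_abelian_2 (K : zmodType) : Prop :=
  forall k : K, (k *+ 2 = 0)%R.

(* Main.v *)
(* If Q is a Steiner loop, the central extension Q x K with product
   (x, a)(y, b) = (xy, a + b + f(x, y)) is a C-loop as soon as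
   f(x, y) + f(x, xy) = f(x, x) = f(y, x) + f(yx, x).  Pick k in K with 2k <> 0,
   orient every triple {x, y, xy} cyclically, and let f(x, x) = k for x <> 1,
   with f(x, y) = 0 or k according to whether (x, y) follows the orientation of
   its triple.  Then x(yx) and (xy)x differ by 2k whenever 1, x, y are distinct,
   so only the elements above 1 are nuclear.  Conversely, x(yx) and (xy)x differ
   by the square of a central element, and loops with at most two cosets of the
   center are flexible. *)
Require Import Defs.
From HB Require Import structures.
From mathcomp Require Import all_boot.
From mathcomp Require Import boolp classical_sets functions cardinality.

Set Implicit Arguments.
Unset Strict Implicit.
Unset Printing Implicit Defensive.

Local Open Scope classical_set_scope.
Local Open Scope card_scope.

(** * Isomorphisms of loops *)

Section Morphisms.
Local Open Scope group_scope.

Lemma isomorphicI (G H : magmaType) (f : G -> H) :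
  {morph f : x y / x * y} -> bijective f -> isomorphic G H.
Proof.
move=> fM fB.
pose m := isMultiplicative.Build G H f fM.
pose g : {multiplicative G -> H} := HB.pack f m.
by exists g.
Qed.

(** Multiplicative maps are only required to preserve products, so the image of [1] is known at
    first only to be idempotent. *)
Lemma loop_idem1 (C : loopType) (x : C) : x * x = x -> x = 1.
Proof. by move=> xx; apply: (@loop_mulgI _ x); rewrite xx mulg1. Qed.

Lemma val_subloopM (C : loopType) (N : set C) (sN : subloop N) :
  {morph (val : subloop_type sN -> C) : x y / x * y}.
Proof. exact: valM. Qed.

Lemma isomorphic_steiner (G Q : loopType) :
  isomorphic G Q -> steiner_loop Q -> steiner_loop G.
Proof.
move=> [g [h gK hK]] /steiner_loopP[QC QK]; apply/steiner_loopP.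
by split=> [x y|x y]; apply: (can_inj gK); rewrite !gmulfM.
Qed.

End Morphisms.

(** * Flexibility forced by the center or by a small quotient *)

Section Center.
Local Open Scope group_scope.
Local Open Scope quotient_scope.
Variable C : loopType.
Notation Z := (center C).
Notation CZ := (loop_quotient (center_normal C)).

Lemma pi_eq_center (x y : C) :
  \pi_CZ x = \pi_CZ y -> exists2 z, Z z & y = x * z.
Proof.
move=> /pi_loop_quotientP xy; have [Z1 _ _ _] := center_subloop C.
have: llcoset y Z y by exists 1; rewrite ?mulg1.
by rewrite -xy => -[z Zz <-]; exists z.
Qed.

Lemma pi_eq1_center (x : C) : \pi_CZ x = 1 -> Z x.
Proof. by move/esym/pi_eq_center => [z Zz ->]; rewrite mul1g. Qed.

Lemma pi_center (z : C) : Z z -> \pi_CZ z = 1.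
Proof.
have [_ ZM Zl _] := center_subloop C => Zz; apply/pi_loop_quotientP/seteqP.
split=> [_ [a Za <-]|_ [a Za <-]].
  by exists (z * a); rewrite ?mul1g //; apply: ZM.
have [b [zba _]] := loop_ldiv z a; exists b; last by rewrite mul1g.
by apply: (Zl z) => //; rewrite zba.
Qed.

(* Both sides of the flexible law are compared with [x (x y) = (x x) y]: if
   [y x = x y c] with [c] central, they differ by [c c]. *)
Lemma C_loop_flexible : C_loop C -> steiner_loop CZ ->
  (forall c, Z c -> c * c = 1) -> flexible C.
Proof.
move=> CC /steiner_loopP[QC QK] Z2 x y.
have lalt (u v : C) : u * (u * v) = (u * u) * v.
  by have := CC 1 u v; rewrite !mul1g.
have ralt (u v : C) : (v * u) * u = v * (u * u).
  by have := CC v u 1; rewrite !mulg1.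
have Zxx : Z (x * x).
  apply: pi_eq1_center; rewrite pi_loop_quotientM.
  by rewrite -[X in _ * X]mulg1 QK.
have [c Zc yx] : exists2 c, Z c & y * x = (x * y) * c.
  by apply: pi_eq_center; rewrite !pi_loop_quotientM QC.
have [[c1 c2 c3] cc] := Zc.
have E : x * (x * y) = ((x * y) * x) * c.
  by rewrite lalt Zxx.2 -ralt yx -c2 cc c3.
by rewrite yx c3 E -c3 Z2 // mulg1.
Qed.

(** Unless [x] or [y] is central, both lie in the one nontrivial coset, so [y = x * z] with [z]
    central. Then [z] can be pulled out, and [x] commutes with the central element [x * x]. *)
Lemma small_quotient_flexible : steiner_loop CZ ->
  (forall u v : CZ, u <> 1 -> v <> 1 -> u = v) -> flexible C.
Proof.
move=> /steiner_loopP[QC QK] small x y.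
have Zxx : Z (x * x).
  apply: pi_eq1_center; rewrite pi_loop_quotientM.
  by rewrite -[X in _ * X]mulg1 QK.
have [/pi_eq1_center[[x1 _ _] _]|Nx] := pselect (\pi_CZ x = 1).
  by rewrite x1.
have [/pi_eq1_center[[_ y2 _] _]|Ny] := pselect (\pi_CZ y = 1).
  by rewrite y2.
have [z [[_ z2 z3] zc] ->] := pi_eq_center (small _ _ Nx Ny).
by rewrite -z2 zc !z3 -z2 zc z3 Zxx.2.
Qed.

End Center.

Lemma card_le_pairP (T : choiceType) (t : T) :
  reflect (forall x y : T, x <> t -> y <> t -> x = y) ([set: T] #<= `I_2).
Proof.
apply: (iffP idP) => [/pcard_leP|small].
  move=> [f] x y xt yt.
  have fI : injective f by move=> a b; apply: (@inj _ _ _ f); rewrite in_setE.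
  have f2 a : (f a < 2)%N by exact: (@funS _ _ _ _ f a).
  have fxt : f x <> f t by move/fI.
  have fyt : f y <> f t by move/fI.
  apply: fI; move: (f2 x) (f2 y) (f2 t) fxt fyt.
  by case: (f x) (f y) (f t) => [|[|?]] [|[|?]] [|[|?]].
(* The map to [I_2] separates [t] from the at most one other element. *)
have -> : [set: T] = (fun x => nat_of_bool (x != t)) @^-1` `I_2.
  by apply/seteqP; split=> // x _ /=; case: (x != t).
apply: card_ge_preimage => x y _ _ /=.
by case: eqP => [->|xt]; case: eqP => [->|yt] //= _; exact: small.
Qed.

(** * Central extensions of a loop by an abelian group *)

Section CentralExtension.
Local Open Scope group_scope.
Import Algebra.
Variables (Q : loopType) (K : zmodType) (f : Q -> Q -> K).

Definition normalized := forall x, f 1 x = 0%R /\ f x 1 = 0%R.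

(** The phantom argument [fn] lets the loop structure be inferred from the type: normalization makes
    [(1, 0)] the unit. *)
Definition central_extension (fn : normalized) : Type := (Q * K)%type.

Hypothesis fn : normalized.
Notation C := (central_extension fn).

HB.instance Definition _ := Choice.on C.

Definition ext_mul (u v : C) : C := (u.1 * v.1, (u.2 + v.2 + f u.1 v.1)%R).

HB.instance Definition _ := hasMul.Build C ext_mul.

Lemma ext_mul1g : left_id ((1, 0%R) : C) (@mul C).
Proof. by case=> x a; congr pair; rewrite /= ?mul1g // (fn x).1 add0r addr0. Qed.

Lemma ext_mulg1 : right_id ((1, 0%R) : C) (@mul C).
Proof. by case=> x a; congr pair; rewrite /= ?mulg1 // (fn x).2 !addr0. Qed.

HB.instance Definition _ := Magma_isUMagma.Build C ext_mul1g ext_mulg1.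

Lemma ext_ldiv (u v : C) : exists! w : C, u * w = v.
Proof.
case: u v => x a [y b]; have [z [xzy _]] := loop_ldiv x y.
exists (z, (b - f x z - a)%R); split.
  by congr pair; rewrite //= addrC [(a + _)%R]addrC addrNK addrC addrNK.
case=> t c [xty abc]; have tz : t = z by apply: (@loop_mulgI _ x); rewrite xzy.
by rewrite -abc tz addrK addrC addKr.
Qed.

Lemma ext_rdiv (u v : C) : exists! w : C, w * u = v.
Proof.
case: u v => x a [y b]; have [z [zxy _]] := loop_rdiv x y.
exists (z, (b - f z x - a)%R); split.
  by congr pair; rewrite //= !addrNK.
case=> t c [txy abc]; have tz : t = z by apply: (@loop_mulIg _ x); rewrite /= zxy.
by rewrite -abc tz !addrK.
Qed.

HB.instance Definition _ := UMagma_isLoop.Build C ext_ldiv ext_rdiv.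

Lemma ext_mulE (u v : C) : u * v = (u.1 * v.1, (u.2 + v.2 + f u.1 v.1)%R) :> C.
Proof. by []. Qed.

(** After cancellation the C-law reads [f y z + f y (y * z) = f x y + f (x * y) y]. The left side is
    free of [x] and the right side of [z]; the hypotheses make both equal to [f y y]. *)
Lemma ext_C_loop : steiner_loop Q ->
  (forall x y, f x y + f x (x * y) = f x x)%R ->
  (forall x y, f y x + f (y * x) x = f x x)%R ->
  C_loop C.
Proof.
move=> /steiner_loopP[QC QK] fl fr [x a] [y b] [z c]; rewrite !ext_mulE /=.
have -> : (x * y) * y = x by rewrite QC [x * y]QC QK.
rewrite QK; congr pair.
rewrite [LHS](AC ((1*((1*3)*1))*1) ((1*2*3*4*7)*(5*6))).
by rewrite [RHS](AC 7 ((1*2*4*6*7)*(3*5))) /= fl fr.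
Qed.

(** Stated for a single pair, so that it refutes both flexibility and the nuclearity of a given
    [u]. *)
Lemma ext_flexible_cocycle (u v : C) : u * (v * u) = (u * v) * u ->
  (f v.1 u.1 + f u.1 (v.1 * u.1) = f u.1 v.1 + f (u.1 * v.1) u.1)%R.
Proof.
case: u v => x a [y b]; rewrite !ext_mulE /= => -[_].
rewrite [LHS](AC (1*3*1) ((1*3*2)*(4*5))).
by rewrite [RHS](AC 5 ((1*4*2)*(3*5))) /= => /addrI.
Qed.

Lemma ext_kernel_central (u : C) : u.1 = 1 -> center C u.
Proof.
case: u => _ a /= ->.
have f1 := fun x => (fn x).1; have f2 := fun x => (fn x).2.
split; first split=> -[x b] [y c]; try case=> x b.
- by rewrite !ext_mulE /= !mul1g !f1 !addr0 !addrA.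
- by rewrite !ext_mulE /= mul1g mulg1 f1 f2 !addr0 !addrA.
- by rewrite !ext_mulE /= !mulg1 !f2 !addr0 !addrA addrAC.
- by rewrite !ext_mulE /= mul1g mulg1 f1 f2 addrC [(a + b)%R]addrC addrC.
Qed.

(** * Extensions whose center is exactly the copy of [K] *)

Section CenterIsKernel.
Hypothesis Z1 : forall u : C, center C u -> u.1 = 1.

Lemma ext_center_isomorphic :
  isomorphic (subloop_type (center_subloop C)) (Algebra.to_multiplicative K).
Proof.
pose T := subloop_type (center_subloop C).
have T1 (u : T) : (val u).1 = 1 by apply/Z1/set_mem/(valP u).
apply: (@isomorphicI T _ (fun u : T => (val u).2 : Algebra.to_multiplicative K)).
  by move=> u v; rewrite val_subloopM ext_mulE /= !T1 (fn 1).1 addr0.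
have inT a : ((1, a) : C) \in center C by apply/mem_set/ext_kernel_central.
exists (fun a => Sub ((1, a) : C) (inT a) : T) => [u|a]; last by rewrite SubK.
by apply: val_inj; rewrite SubK -(T1 u); case: (val u).
Qed.

Lemma ext_quotient_isomorphic :
  isomorphic (loop_quotient (center_normal C)) Q.
Proof.
pose R := loop_quotient (center_normal C).
have pi1 (u v : C) : (\pi_R u = \pi_R v)%qT <-> u.1 = v.1.
  split=> [/pi_eq_center[z /Z1 z1 ->]|uv].
    by rewrite ext_mulE /= z1 mulg1.
  (* Elements with the same first component differ by a factor from the kernel. *)
  have -> : v = u * ((1, (v.2 - u.2)%R) : C).
    case: v uv => y b /= <-; rewrite ext_mulE /= mulg1 (fn _).2 addr0.
    by rewrite addrC addrNK.
  rewrite pi_loop_quotientM [X in _ = _ * X]pi_center ?mulg1 //.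
  exact: ext_kernel_central.
apply: (@isomorphicI R _ (fun u : R => (repr u).1)).
  move=> u v; rewrite -[_ * _ in RHS]/((repr u * repr v).1).
  by apply/pi1; rewrite reprK pi_loop_quotientM !reprK.
exists (fun x => \pi_R ((x, 0%R) : C))%qT => [u|x].
  by rewrite -[RHS]reprK; apply/pi1.
by apply/(pi1 _ ((x, 0%R) : C)); rewrite reprK.
Qed.

End CenterIsKernel.
End CentralExtension.

(** * Cyclic orientations of the triples of a Steiner loop *)

Section SteinerOrientation.
Local Open Scope group_scope.
Variables (Q : loopType).
Hypothesis hQ : steiner_loop Q.
Implicit Types x y : Q.

Let QC : commutative (@mul Q). Proof. by have [] := (steiner_loopP Q).1 hQ. Qed.
Let QK x y : x * (x * y) = y.
Proof. by have [_] := (steiner_loopP Q).1 hQ. Qed.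
Let QKr x y : (x * y) * y = x. Proof. by rewrite QC [x * y]QC QK. Qed.

Lemma steiner_exp2 x : x * x = 1.
Proof. by rewrite -[X in x * X]mulg1 QK. Qed.

Lemma steiner_mul_neq x y : x != 1 -> y != 1 -> x != y ->
  [/\ x * y != 1, x * y != x & x * y != y].
Proof.
move=> x1 y1 xy; split; apply/eqP => E.
- by case/eqP: xy; rewrite -[x](QKr x y) E mul1g.
- by case/eqP: y1; apply: (@loop_mulgI _ x); rewrite E mulg1.
- by case/eqP: x1; apply: (@loop_mulIg _ y); rewrite /= E mul1g.
Qed.

(** Consecutive pairs of the cyclic order [x], [y], [x * y]; exchanging [x] and [y] reverses this
    order. *)
Definition cyclic_pairs x y := [:: (x, y); (y, x * y); (x * y, x)].

Definition block x y (p : Q * Q) :=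
  (p \in cyclic_pairs x y) || (p \in cyclic_pairs y x).

(* The chosen pair depends only on the set of six ordered pairs from the triple
   [{x, y, x * y}], so it orients the triple cyclically. *)
Definition oriented x y : bool :=
  choose (block x y) (x, y) \in cyclic_pairs x y.

Lemma cyclic_pairsS x y : cyclic_pairs y (x * y) =i cyclic_pairs x y.
Proof.
move=> p; rewrite !inE [y * (x * y)]QC QKr.
by case: (p == (x, y)); rewrite ?orbT ?orbF.
Qed.

Lemma cyclic_pairsN x y : cyclic_pairs (x * y) y =i cyclic_pairs y x.
Proof.
move=> p; rewrite !inE QKr [y * x]QC.
by case: (p == (x * y, y)); rewrite ?orbT ?orbF.
Qed.

Lemma block_sym x y : block y x =1 block x y.
Proof. by move=> p; exact: orbC. Qed.

Lemma blockS x y : block y (x * y) =1 block x y.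
Proof. by move=> p; rewrite /block cyclic_pairsS cyclic_pairsN. Qed.

Lemma block_refl x y : block x y (x, y).
Proof. by rewrite /block !inE eqxx. Qed.

(** Rotating the triple changes neither its block nor its cyclic order, and [choose] returns the
    same pair from any starting point in the block. *)
Lemma orientedS x y : oriented y (x * y) = oriented x y.
Proof.
rewrite /oriented (eq_choose (blockS x y)) cyclic_pairsS.
suff -> : choose (block x y) (y, x * y) = choose (block x y) (x, y) by [].
apply: choose_id; last exact: block_refl.
by rewrite -blockS; exact: block_refl.
Qed.

Lemma orientedC x y : x != 1 -> y != 1 -> x != y ->
  oriented y x = ~~ oriented x y.
Proof.
move=> x1 y1 xy; rewrite /oriented (eq_choose (block_sym x y)).
have -> : choose (block x y) (y, x) = choose (block x y) (x, y).
  apply: choose_id; last exact: block_refl.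
  by rewrite -block_sym; exact: block_refl.
have [_ xyx xyy] := steiner_mul_neq x1 y1 xy.
(* The chosen pair is one of six; since [x], [y], [x * y] are distinct, it lies in just one of the
   two cyclic orders. *)
have := chooseP (block_refl x y); case: (choose _ _) => a b.
rewrite /block !inE [y * x]QC /= !xpair_eqE => /orP[]/or3P[]/andP[/eqP-> /eqP->];
  rewrite !eqxx ![_ == x * y]eq_sym 1?[y == x]eq_sym;
  by rewrite (negPf xy) (negPf xyx) (negPf xyy) ?andbF ?orbT.
Qed.

(** * The cocycle of an orientation *)

Section Cocycle.
Import Algebra.
Variables (K : zmodType) (k : K).

Definition cocycle x y : K :=
  if (x == 1) || (y == 1) then 0%R
  else if (x == y) || ~~ oriented x y then k else 0%R.

Lemma cocycle_normalized : normalized cocycle.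
Proof. by move=> x; rewrite /cocycle eqxx orbT. Qed.

(** In the generic case [(x, x * y)] is a rotation of [(y, x)], hence oriented oppositely to
    [(x, y)]: exactly one of the two terms is [k]. *)
Lemma cocycle_ldiv x y : (cocycle x y + cocycle x (x * y) = cocycle x x)%R.
Proof.
rewrite /cocycle; have [->|x1] /= := eqVneq x 1; first by rewrite addr0.
have [->|y1] /= := eqVneq y 1; first by rewrite mulg1 (negPf x1) eqxx add0r.
have [<-|xy] /= := eqVneq x y; first by rewrite steiner_exp2 !eqxx addr0.
have [/negPf-> xyx _] := steiner_mul_neq x1 y1 xy.
rewrite eqxx /= [x == x * y]eq_sym (negPf xyx) [x * y]QC orientedS (orientedC x1 y1) //.
by case: (oriented x y); rewrite /= ?add0r ?addr0.
Qed.

Lemma cocycle_rdiv x y : (cocycle y x + cocycle (y * x) x = cocycle x x)%R.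
Proof.
rewrite /cocycle; have [->|x1] /= := eqVneq x 1; first by rewrite !orbT addr0.
have [->|y1] /= := eqVneq y 1; first by rewrite mul1g (negPf x1) eqxx add0r.
have [<-|xy] /= := eqVneq x y.
  by rewrite eqxx steiner_exp2 eqxx addr0.
have [yx1 _ yxx] := steiner_mul_neq y1 x1 (contra_neq esym xy).
rewrite (negPf yx1) eqxx (negPf yxx) /=.
rewrite (orientedC x1 yx1) 1?eq_sym // orientedS.
by case: (oriented y x); rewrite /= ?add0r ?addr0.
Qed.

(** The two pairs on the left follow one cyclic order and the two on the right its reverse, so one
    side is [k + k] and the other [0]. *)
Lemma cocycle_nonflexible x y : x != 1 -> y != 1 -> x != y -> (k *+ 2 <> 0)%R ->
  (cocycle y x + cocycle x (y * x) <> cocycle x y + cocycle (x * y) x)%R.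
Proof.
move=> x1 y1 xy k2; have [xy1 xyx _] := steiner_mul_neq x1 y1 xy.
rewrite [y * x]QC /cocycle (negPf x1) (negPf y1) (negPf xy1) [y == x]eq_sym.
rewrite (negPf xy) [x == x * y]eq_sym (negPf xyx) /=.
rewrite (orientedC x1 xy1) 1?eq_sym // [x * y]QC orientedS (orientedC x1 y1) //.
by case: (oriented x y); rewrite /= -[(k + k)%R]mulr2n addr0 // => /esym.
Qed.

End Cocycle.
End SteinerOrientation.

Theorem theorem5p7 (K : zmodType) (Q : loopType) (hQ : steiner_loop Q) :
  ((exists C : loopType,
      [/\ C_loop C,
          ~ flexible C,
          isomorphic (subloop_type (center_subloop C)) (Algebra.to_multiplicative K) &
          isomorphic (loop_quotient (center_normal C)) Q])
   <-> (~~ ([set: Q] #<= `I_2) /\ ~ elementary_abelian_2 K))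
  /\
  (~~ ([set: Q] #<= `I_2) /\ ~ elementary_abelian_2 K ->
   exists C : loopType,
      [/\ C_loop C,
          ~ flexible C,
          isomorphic (subloop_type (center_subloop C)) (Algebra.to_multiplicative K),
          isomorphic (loop_quotient (center_normal C)) Q &
          center C = nucleus C]).
Proof.
(* The stronger existence claim also yields one direction of the equivalence. *)
suff ext : ~~ ([set: Q] #<= `I_2) /\ ~ elementary_abelian_2 K ->
   exists C : loopType,
      [/\ C_loop C,
          ~ flexible C,
          isomorphic (subloop_type (center_subloop C)) (Algebra.to_multiplicative K),
          isomorphic (loop_quotient (center_normal C)) Q &
          center C = nucleus C].
  split=> //; split=> [[C [CC nf isoZ isoQ]]|/ext[C [CC nf isoZ isoQ _]]]; last first.
    by exists C.
  have stCZ := isomorphic_steiner isoQ hQ.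
  split.
    apply/negP => /(card_le_pairP 1%g) small; apply/nf/small_quotient_flexible => //.
    case: isoQ => g [h gK hK] u v u1 v1; apply: (can_inj gK).
    have g1 : g 1%g = 1%g by apply: loop_idem1; rewrite -gmulfM mulg1.
    by apply: small; rewrite -g1 => /(can_inj gK).
  move=> K2; apply/nf/C_loop_flexible => // c Zc.
  case: isoZ => g [h gK hK].
  pose c' : subloop_type (center_subloop C) := Sub c (mem_set Zc).
  have sq1 (w : Algebra.to_multiplicative K) : (w * w = 1)%g.
    by rewrite -[RHS](K2 w).
  have E : (c' * c')%g = 1%g.
    by apply: (can_inj gK); rewrite gmulfM sq1 -(sq1 (g 1%g)) -gmulfM mulg1.
  by have := congr1 val E; rewrite val_subloopM SubK.
move=> [/(card_le_pairP 1%g) Q3 K2].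
have [k k2] : exists k : K, (k *+ 2 <> 0)%R by apply/existsNP.
pose fn := cocycle_normalized k : normalized (@cocycle Q K k).
pose C : loopType := central_extension fn.
have [x0 [y0 [x01 y01 xy0]]] : exists x y : Q, [/\ x != 1%g, y != 1%g & x != y].
  apply: contrapT => nexy; apply: Q3 => x y /eqP x1 /eqP y1.
  by apply/eqP/negPn/negP => xy; apply: nexy; exists x, y.
(* Excluding every [u] with [u.1 <> 1] from the nucleus takes a second element for each [u.1]; one
   of [x0], [y0] always serves. *)
have partner (x : Q) : x != 1%g -> exists2 y : Q, y != 1%g & x != y.
  move=> x1; have [E|] := eqVneq x x0; first by exists y0; rewrite ?E.
  by exists x0.
have nuc1 (u : C) : nucleus C u -> u.1 = 1%g.
  (* The left nuclear identity of [u], taken at a lift of [y] and at [u] itself, is an instance of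
     the flexible law. *)
  move=> [u1 _ _]; apply/eqP/negPn/negP => x1; have [y y1 xy] := partner _ x1.
  apply: (cocycle_nonflexible hQ x1 y1 xy k2).
  exact: (ext_flexible_cocycle (v := ((y, 0%R) : C)) (u1 _ _)).
have cen1 (u : C) : center C u -> u.1 = 1%g by case=> /nuc1.
exists C; split.
- by apply: ext_C_loop => // x y; [exact: cocycle_ldiv|exact: cocycle_rdiv].
- move=> fl; apply: (cocycle_nonflexible hQ x01 y01 xy0 k2).
  exact: (ext_flexible_cocycle (fl ((x0, 0%R) : C) ((y0, 0%R) : C))).
- exact: ext_center_isomorphic.
- exact: ext_quotient_isomorphic.
- by apply/seteqP; split=> u; [case|move/nuc1/ext_kernel_central].
Qed.
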